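(* For any nontrivial elements $g,h\in A_\infty$, the following inequality holds: $$\frac{\lambda(g)}{\lambda(h)}\leq \lambda_h(g)\leq 4\,\frac{\lambda(g)}{\lambda(h)}+4.$$
   Context: $S_\infty$ (the infinite symmetric group) is the group of all bijections of $\mathbb{N}=\{1,2,3,\dots\}$ with finite support, and $A_\infty$ (the infinite alternating group) is its subgroup of even permutations; $A_\infty$ is a simple group. For a group $G$ and $g\in G$, let $C_g$ be the conjugacy class of $g$ in $G$ and $[g]:=C_g\cup C_{g^{-1}}$. For nontrivial $g,h\in G$, $\lambda_h(g)$ denotes the minimum $n$ such that $g=h_1h_2\cdots h_n$ with all $h_i\in[h]$ (and $\lambda_h(g)=\infty$ if there is no such expression; this does not occur when $G$ is simple). In the statement, $\lambda_h(g)$ is taken in $G=A_\infty$. For $g\in S_\infty$, the word length $\lambda(g)$ is $\lambda_{\iota_1}(g)$ computed in $G=S_\infty$, where $\iota_1=(1\ 2)$; that is, $\lambda(g)$ is the minimum number of transpositions in an expression of $g$ as a product of transpositions. *)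

(* Defs.v *)
(* MathComp, with classical logic from mathcomp.classical.boolp. *)
From HB Require Import structures.
From mathcomp Require Import all_boot all_order all_algebra.
From mathcomp Require Import finmap.
From mathcomp Require Import boolp classical_sets constructive_ereal.

Set Implicit Arguments.
Unset Strict Implicit.
Unset Printing Implicit Defensive.

Local Open Scope group_scope.
Local Open Scope classical_set_scope.

Section WordLength.
Variable G : groupType.
Implicit Types g h : G.

Definition conj_class h : set G := [set h ^ x | x in [set: G]].

Definition sym_class h : set G := conj_class h `|` conj_class h^-1.

Definition is_product_of_length h g (n : nat) : Prop :=
  exists2 s : 'I_n -> G,
    forall i, sym_class h (s i) & g = \prod_(i < n) s i.

Definition is_product_of_lengthb h g : pred nat :=
  fun n => `[< is_product_of_length h g n >].

(* The minimal length is a natural number or infinite; it is valued in \bar rat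
   so that it can be divided and compared. *)
Definition word_length h g : \bar rat :=
  if pselect (exists n, is_product_of_lengthb h g n) is left exP
  then ((ex_minn exP)%:R%R)%:E%E else +oo%E.

End WordLength.

(* The points permuted are 0, 1, 2, ... instead of 1, 2, 3, ... .  The default
   of {fsfun nat -> nat} is the identity, so its inhabitants are the maps moving
   finitely many points. *)
Record S_inf := SInf {
  S_inf_fun :> {fsfun nat -> nat};
  _ : `[< bijective S_inf_fun >]
}.

HB.instance Definition _ := [isSub for S_inf_fun].
HB.instance Definition _ := [Choice of S_inf by <:].

Section SInfGroup.
Implicit Types f g h : S_inf.

Lemma S_inf_bij f : bijective f.
Proof. by case: f => f /= /asboolP. Qed.

Lemma S_infP f g : f =1 g <-> f = g.
Proof. by split=> [/fsfunP/val_inj|->]. Qed.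

Lemma S_inf_one_subproof : `[< bijective [fsfun for (@id nat)] >].
Proof. by apply/asboolP; exists id => x; rewrite !fsfun0E. Qed.

Definition S_inf_one : S_inf := SInf S_inf_one_subproof.

Lemma S_inf_mul_subproof f g : `[< bijective (fsfun_comp (val f) (val g)) >].
Proof.
apply/asboolP/(eq_bij (bij_comp (S_inf_bij f) (S_inf_bij g))) => x.
by rewrite fscompE.
Qed.

Definition S_inf_mul f g : S_inf := SInf (S_inf_mul_subproof f g).

Lemma S_inf_mulE f g x : S_inf_mul f g x = f (g x).
Proof. exact: fscompE. Qed.

Lemma S_inf_oneE x : S_inf_one x = x.
Proof. exact: fsfun0E. Qed.

Lemma S_inf_surj f (y : nat) : exists x, f x == y.
Proof. by have [f' _ f'K] := S_inf_bij f; exists (f' y); rewrite f'K. Qed.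

Definition S_inf_preim f (y : nat) : nat := xchoose (S_inf_surj f y).

Definition S_inf_inv_fun f : {fsfun nat -> nat} :=
  [fsfun y in finsupp f => S_inf_preim f y].

Lemma S_inf_preimK f : cancel (S_inf_preim f) f.
Proof. by move=> y; apply/eqP/(xchooseP (S_inf_surj f y)). Qed.

Lemma S_inf_inv_funE f : S_inf_inv_fun f =1 S_inf_preim f.
Proof.
move=> y; rewrite fsfunE; case: ifPn => // yNf.
by apply: (bij_inj (S_inf_bij f)); rewrite S_inf_preimK fsfun_dflt.
Qed.

Lemma S_inf_inv_funK f : cancel (S_inf_inv_fun f) f.
Proof. by move=> y; rewrite S_inf_inv_funE S_inf_preimK. Qed.

Lemma S_inf_funK f : cancel f (S_inf_inv_fun f).
Proof.
by move=> x; apply: (bij_inj (S_inf_bij f)); rewrite S_inf_inv_funK.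
Qed.

Lemma S_inf_inv_subproof f : `[< bijective (S_inf_inv_fun f) >].
Proof.
by apply/asboolP; exists f; [exact: S_inf_inv_funK | exact: S_inf_funK].
Qed.

Definition S_inf_inv f : S_inf := SInf (S_inf_inv_subproof f).

Lemma S_inf_mulA : associative S_inf_mul.
Proof. by move=> f g h; apply/val_inj/fscompA. Qed.

Lemma S_inf_mul1g : left_id S_inf_one S_inf_mul.
Proof. by move=> f; apply/S_infP => x; rewrite S_inf_mulE S_inf_oneE. Qed.

Lemma S_inf_mulg1 : right_id S_inf_one S_inf_mul.
Proof. by move=> f; apply/S_infP => x; rewrite S_inf_mulE S_inf_oneE. Qed.

Lemma S_inf_mulVg : left_inverse S_inf_one S_inf_inv S_inf_mul.
Proof.
by move=> f; apply/S_infP => x; rewrite S_inf_mulE S_inf_oneE S_inf_funK.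
Qed.

Lemma S_inf_mulgV : right_inverse S_inf_one S_inf_inv S_inf_mul.
Proof.
by move=> f; apply/S_infP => x; rewrite S_inf_mulE S_inf_oneE S_inf_inv_funK.
Qed.

End SInfGroup.

HB.instance Definition _ := isGroup.Build S_inf
  S_inf_mulA S_inf_mul1g S_inf_mulg1 S_inf_mulVg S_inf_mulgV.

Section Transpositions.
Variables i j : nat.

Definition transp_fun : {fsfun nat -> nat} :=
  [fsfun x in [fset i; j]%fset => if x == i then j else i].

Lemma transp_funE x :
  transp_fun x = if x == i then j else if x == j then i else x.
Proof. by rewrite fsfunE !inE; case: eqVneq. Qed.

Lemma transp_funK : involutive transp_fun.
Proof.
move=> x; rewrite !transp_funE.
have [->|xi] := eqVneq x i; first by rewrite eqxx; case: eqVneq.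
have [->|xj] := eqVneq x j; first by rewrite eqxx.
by rewrite (negPf xi) (negPf xj).
Qed.

Lemma transp_subproof : `[< bijective transp_fun >].
Proof. exact/asboolP/inv_bij/transp_funK. Qed.

Definition transp : S_inf := SInf transp_subproof.

End Transpositions.

Definition is_transp (t : S_inf) : Prop :=
  exists i j : nat, i <> j /\ t = transp i j.

Definition is_even_perm (g : S_inf) : Prop :=
  exists n : nat, ~~ odd n /\
  exists2 s : 'I_n -> S_inf,
    forall k, is_transp (s k) & g = \prod_(k < n) s k.

Definition even_perm : pred S_inf := fun g => `[< is_even_perm g >].

Lemma transpV i j : (transp i j)^-1 = transp i j.
Proof.
apply: (mulgI (transp i j)); rewrite mulgV; apply/S_infP => x.
by rewrite S_inf_mulE S_inf_oneE transp_funK.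
Qed.

Lemma even_permM g h : even_perm g -> even_perm h -> even_perm (g * h).
Proof.
move=> /asboolP[m [em [s sT ->]]] /asboolP[n [en [t tT ->]]].
apply/asboolP; exists (m + n)%N; split.
  by rewrite oddD negb_add (negPf em) (negPf en).
exists (fun k => match split k with inl a => s a | inr b => t b end).
  by move=> k; case: (split k).
rewrite big_split_ord /=; congr (_ * _); apply: eq_bigr => a _.
  by rewrite -[lshift _ _]/(unsplit (inl a)) unsplitK.
by rewrite -[rshift _ _]/(unsplit (inr a)) unsplitK.
Qed.

Lemma even_permV g : even_perm g -> even_perm g^-1.
Proof.
move=> /asboolP[n [en [s sT ->]]]; apply/asboolP; exists n; split=> //.
exists (fun k => (s (rev_ord k))^-1).
  move=> k; have [i [j [ij ->]]] := sT (rev_ord k).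
  by exists i, j; rewrite transpV.
elim: n s {en sT} => [|n IHn] s; first by rewrite !big_ord0 invg1.
rewrite big_ord_recr invgM big_ord_recl /= IHn; congr (_ * _).
  by congr (s _)^-1; apply: val_inj; rewrite /= subn1.
by apply: eq_bigr => k _; congr (s _)^-1; apply: val_inj; rewrite /= subSS.
Qed.

Lemma even_perm_group_closed : group_closed even_perm.
Proof.
split=> [|g h]; last by move=> ge he; apply: even_permM => //; apply: even_permV.
apply/asboolP; exists 0%N; split=> //.
by exists (fun _ => 1); [case | rewrite big_ord0].
Qed.

Record A_inf := AInf {
  A_inf_perm :> S_inf;
  _ : even_perm A_inf_perm
}.

HB.instance Definition _ := [isSub for A_inf_perm].
HB.instance Definition _ := [Choice of A_inf by <:].
HB.instance Definition _ :=
  SubChoice_isSubGroup.Build S_inf even_perm A_inf even_perm_group_closed.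

(* transp 0 1 is an involution and its conjugates are the transpositions, so
   this is the least number of transpositions with product g. *)
Definition transp_length (g : S_inf) : \bar rat := word_length (transp 0 1) g.

(* Main.v *)
Require Import Defs.
From mathcomp Require Import all_boot all_order all_algebra.
From mathcomp Require Import constructive_ereal.
From mathcomp Require Import finmap boolp classical_sets perm.

(** Write l(g) for the least number of transpositions with product g.

    Lower bound: l is subadditive and invariant under conjugation and
    inversion, so a product of n elements of [h] has length at most n l(h).

    Upper bound: since g and h are even, l(g) and l(h) are even, and a shortest
    word for g in transpositions can be cut into at most l(g) / l(h) + 1
    factors, each an even permutation of length at most l(h).  So it is enough
    that an even permutation g with l(g) <= l(h) is a product of four conjugates
    of h ([four_conjugates]).  Two facts give this.

    - Two conjugates of h can be made to overlap so that their product is a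
      single cycle on 2n + 1 points for some n >= l(h) ([join_conjugate]): the
      cycles of h and those of the conjugate are strung together like a tree,
      two of them meeting in at most one point, and the product of cycles
      arranged along a tree is a cycle through all the points.
    - An even permutation of an odd number N of points is a product of two
      N-cycles ([even_two_cycles]).

    A product of at most l(h) transpositions moves at most 2 l(h) < 2n + 1
    points, so it is a product of two (2n + 1)-cycles, each of which is
    conjugate to the cycle of the first fact, hence a product of two conjugates
    of h.  It does not matter whether the conjugations are done in the
    symmetric or in the alternating group ([sym_class_A_inf]).

    Neither fact is proved through a decomposition into disjoint cycles: both
    go by induction on the support, removing a moved point u from g by passing
    to g * transp (g^-1 u) u, which fixes u. *)

Set Implicit Arguments.
Unset Strict Implicit.
Unset Printing Implicit Defensive.

Local Open Scope group_scope.

(** * Words in a symmetrized conjugacy class *)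

Lemma product_length0 (G : groupType) (h g : G) :
  is_product_of_length h g 0 <-> g = 1.
Proof.
split=> [[s _ ->]|->]; first by rewrite big_ord0.
by exists (fun=> 1); [case | rewrite big_ord0].
Qed.

Lemma product_lengthS (G : groupType) (h g : G) n :
  is_product_of_length h g n.+1 <->
  exists a b, [/\ sym_class h a, is_product_of_length h b n & g = a * b].
Proof.
split=> [[s sP ->]|[a [b [aP [s sP ->] ->]]]].
  exists (s ord0), (\prod_(i < n) s (lift ord0 i)); split=> //.
    by exists (fun i => s (lift ord0 i)).
  by rewrite big_ord_recl.
exists (fun i => if unlift ord0 i is Some j then s j else a).
  by move=> i; case: unliftP.
by rewrite big_ord_recl unlift_none; congr (_ * _); apply: eq_bigr => i _;
  rewrite liftK.
Qed.

Lemma product_length1 (G : groupType) (h g : G) :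
  is_product_of_length h g 1 <-> sym_class h g.
Proof.
rewrite product_lengthS; split=> [[a [b [aP /product_length0-> ->]]]|gP].
  by rewrite mulg1.
by exists g, 1; split=> //; [apply/product_length0 | rewrite mulg1].
Qed.

Lemma product_length_mul (G : groupType) (h a b : G) m n :
  is_product_of_length h a m -> is_product_of_length h b n ->
  is_product_of_length h (a * b) (m + n).
Proof.
elim: m a => [|m IHm] a; first by move=> /product_length0->; rewrite mul1g.
move=> /product_lengthS[x [y [xP yP ->]]] bP; apply/product_lengthS.
by exists x, (y * b); split=> //; [apply: IHm | rewrite mulgA].
Qed.

Lemma product_length_split (G : groupType) (h g : G) m n :
  is_product_of_length h g (m + n) ->
  exists a b, [/\ is_product_of_length h a m, is_product_of_length h b n &
                  g = a * b].
Proof.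
elim: m g => [|m IHm] g.
  by move=> gP; exists 1, g; split; rewrite ?mul1g //; apply/product_length0.
move=> /product_lengthS[x [y [xP /IHm[a [b [aP bP ->]]] ->]]].
exists (x * a), b; split=> //; last by rewrite mulgA.
by apply/product_lengthS; exists x, a.
Qed.

Lemma sym_class_refl (G : groupType) (h : G) : sym_class h h.
Proof. by left; exists 1; rewrite ?conjg1. Qed.

Lemma sym_classJ (G : groupType) (h a x : G) :
  sym_class h a -> sym_class h (a ^ x).
Proof. by case=> -[y _ <-]; [left|right]; exists (y * x); rewrite ?conjgM. Qed.

Lemma sym_classV (G : groupType) (h a : G) : sym_class h a -> sym_class h a^-1.
Proof.
by case=> -[y _ <-]; [right|left]; exists y; rewrite // conjVg ?invgK.
Qed.

Lemma product_lengthJ (G : groupType) (h g x : G) n :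
  is_product_of_length h g n -> is_product_of_length h (g ^ x) n.
Proof.
case=> s sP ->; exists (fun i => s i ^ x); last by rewrite conjg_prod.
by move=> i; apply: sym_classJ.
Qed.

Lemma product_lengthV (G : groupType) (h g : G) n :
  is_product_of_length h g n -> is_product_of_length h g^-1 n.
Proof.
elim: n g => [|n IHn] g; first by move/product_length0->; rewrite invg1;
  apply/product_length0.
move=> /product_lengthS[a [b [aP bP ->]]]; rewrite invgM -addn1.
by apply: product_length_mul (IHn _ bP) _; apply/product_length1/sym_classV.
Qed.

Lemma product_length_trans (G : groupType) (k h g : G) m n :
  is_product_of_length k h m -> is_product_of_length h g n ->
  is_product_of_length k g (n * m).
Proof.
move=> hP; elim: n g => [|n IHn] g.
  by move=> /product_length0->; apply/product_length0.
move=> /product_lengthS[a [b [aP bP ->]]]; rewrite mulSn.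
apply: product_length_mul (IHn _ bP).
by case: aP => -[x _ <-]; rewrite ?conjVg; [|apply: product_lengthV];
  apply: product_lengthJ.
Qed.

Lemma word_lengthP (G : groupType) (h g : G) n :
  is_product_of_length h g n ->
  exists m, [/\ word_length h g = (m%:R%R)%:E%E, is_product_of_length h g m &
    forall k, is_product_of_length h g k -> (m <= k)%N].
Proof.
move=> gP; rewrite /word_length; case: pselect => [exP|[]]; last first.
  by exists n; apply/asboolP.
exists (ex_minn exP); case: ex_minnP => m /asboolP mP min_m; split=> // k kP.
by apply: min_m; apply/asboolP.
Qed.

(** * Finitely supported permutations *)

Lemma S_mulE (f g : S_inf) x : (f * g) x = f (g x).
Proof. exact: S_inf_mulE. Qed.

Lemma S_oneE x : (1 : S_inf) x = x.
Proof. exact: S_inf_oneE. Qed.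

Lemma S_invK (f : S_inf) : cancel f f^-1.
Proof. by move=> x; rewrite -S_mulE mulVg S_oneE. Qed.

Lemma S_invKV (f : S_inf) : cancel f^-1 f.
Proof. by move=> x; rewrite -S_mulE mulgV S_oneE. Qed.

Lemma S_inj (f : S_inf) : injective f.
Proof. exact: can_inj (S_invK f). Qed.

Lemma transpE i j x :
  transp i j x = if x == i then j else if x == j then i else x.
Proof. exact: transp_funE. Qed.

Lemma transpL i j : transp i j i = j.
Proof. by rewrite transpE eqxx. Qed.

Lemma transpR i j : transp i j j = i.
Proof. by rewrite transpE eqxx; case: eqVneq. Qed.

Lemma transpD i j x : x != i -> x != j -> transp i j x = x.
Proof. by move=> xi xj; rewrite transpE (negPf xi) (negPf xj). Qed.

Lemma transpC i j : transp i j = transp j i.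
Proof.
by apply/S_infP => x; rewrite !transpE; do 2!case: eqVneq => // ?; subst.
Qed.

Lemma transp2 i j : transp i j * transp i j = 1.
Proof. by rewrite -{1}transpV mulVg. Qed.

Lemma transpMK (g : S_inf) i j : g * transp i j * transp i j = g.
Proof. by rewrite -mulgA transp2 mulg1. Qed.

Lemma mul_transp (s : S_inf) i j : s * transp i j = transp (s i) (s j) * s.
Proof.
apply/S_infP => x; rewrite !S_mulE !transpE !(inj_eq (@S_inj s)).
by do 2!case: eqP => //.
Qed.

Lemma transpJ (s : S_inf) i j : transp i j ^ s^-1 = transp (s i) (s j).
Proof. by rewrite conjgE invgK mulgA mul_transp mulgK. Qed.

Lemma conj_transp_fix (s : S_inf) i j : s i = i -> s j = j ->
  s ^ transp i j = s.
Proof.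
by move=> si sj; rewrite conjgE mul_transp si sj transpV mulgA transp2 mul1g.
Qed.

Lemma exists_notin (l : seq nat) : exists x, x \notin l.
Proof.
exists (\max_(x <- l) x).+1; apply/negP => /(@leq_bigmax_seq _ _ xpredT id).
by move/(_ isT); rewrite ltnn.
Qed.

Lemma S_inf_support (g : S_inf) :
  exists l : seq nat, forall x, g x != x -> x \in l.
Proof. by exists (finsupp g) => x; rewrite mem_finsupp. Qed.

(** This makes any two cycles of equal length conjugate, by [cyc_map] below. *)
Lemma extend_injection (s t : seq nat) : uniq s -> uniq t -> size s = size t ->
  exists f : S_inf, map f s = t.
Proof.
elim: s t => [|x s IHs] [|y t] //=; first by exists 1.
move=> /andP[xs us] /andP[yt ut] [/(IHs _ us ut)[f ft]].
exists (transp (f x) y * f); rewrite S_mulE transpL; congr (_ :: _).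
rewrite -{}ft in yt *; apply/eq_in_map => z zs; rewrite S_mulE transpD //.
  by rewrite (inj_eq (@S_inj f)); apply: contraNneq xs => <-.
by apply: contraNneq yt => <-; apply: map_f.
Qed.

(** Multiplying g by transp (g^-1 u) u cuts u out of its cycle. *)
Lemma fix_remove (g : S_inf) u : (g * transp (g^-1 u) u) u = u.
Proof. by rewrite S_mulE transpR S_invKV. Qed.

Lemma supp_remove (g : S_inf) u x : (g * transp (g^-1 u) u) x != x ->
  x != u /\ g x != x.
Proof.
move=> gx; have xu : x != u.
  by apply: contraNneq gx => ->; rewrite fix_remove.
split=> //; have [xp|xp] := eqVneq x (g^-1 u);
  first by rewrite xp S_invKV -xp eq_sym.
by rewrite S_mulE transpD in gx.
Qed.

Lemma inv_fixed (g : S_inf) u : (g^-1 u == u) = (g u == u).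
Proof. by rewrite -(inj_eq (@S_inj g)) S_invKV eq_sym. Qed.

Lemma ex_moved (g : S_inf) : g <> 1 -> exists u, g u != u.
Proof.
move=> g1; apply: contrapT => /forallNP gfix; case: g1; apply/S_infP => x.
by rewrite S_oneE; have /negP/negPn/eqP := gfix x.
Qed.

(** Every permutation arises from 1 by inserting one new point u at a time just
    after a point p: if h fixes u then h * transp p u sends p to u and u to
    h p. *)
Lemma S_inf_ind (P : S_inf -> Prop) : P 1 ->
  (forall (h : S_inf) p u, p != u -> h u = u -> P h -> P (h * transp p u)) ->
  forall g, P g.
Proof.
move=> P1 PS g; have [l] := S_inf_support g.
elim: {l}(size l) {-2}l (leqnn (size l)) g => [|n IHn] l ln g gl.
  suff -> : g = 1 by [].
  apply/S_infP => x; rewrite S_oneE; apply/eqP/negPn/negP => /gl.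
  by case: l ln {gl}.
have [->//|g1] := pselect (g = 1).
have [u gu] := ex_moved g1.
rewrite -(mulgK (transp (g^-1 u) u) g) transpV; apply: PS.
- by rewrite inv_fixed.
- exact: fix_remove.
apply: (IHn (rem u l)) => [|x /supp_remove[xu /gl]].
  by rewrite size_rem ?gl // -subn1 leq_subLR.
by rewrite (perm_mem (perm_to_rem (gl _ gu))) inE (negPf xu).
Qed.

Lemma sym_class_transp (t : S_inf) : sym_class (transp 0 1) t <-> is_transp t.
Proof.
split.
  rewrite /sym_class transpV => -[] -[x _ <-]; rewrite -(invgK x) transpJ;
  by exists (x^-1 0%N), (x^-1 1%N); split=> // /S_inj.
case=> i [j [/eqP ij ->]];
  have [|||s [<- <-]]// := @extend_injection [:: 0%N; 1%N] [:: i; j].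
  by rewrite /= inE ij.
by left; exists s^-1; rewrite ?transpJ.
Qed.

Lemma transp_product_length i j :
  i != j -> is_product_of_length (transp 0 1) (transp i j) 1.
Proof.
by move=> /eqP ij; apply/product_length1/sym_class_transp; exists i, j.
Qed.

Lemma exists_transp_product (g : S_inf) :
  exists n, is_product_of_length (transp 0 1) g n.
Proof.
elim/S_inf_ind: g => [|h p u pu _ [n hn]]; first by exists 0;
  apply/product_length0.
by exists (n + 1)%N; apply: product_length_mul => //;
  apply: transp_product_length.
Qed.

Lemma even_permP (g : S_inf) : even_perm g <->
  exists2 n, ~~ odd n & is_product_of_length (transp 0 1) g n.
Proof.
split=> [/asboolP[n [en [s sP ->]]]|[n en [s sP ->]]].
  by exists n => //; exists s => // i; apply/sym_class_transp.
by apply/asboolP; exists n; split=> //; exists s => // i;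
  apply/sym_class_transp.
Qed.

(** * Parity *)

(** The parity of the symmetric groups of finite sets is transferred: a word in
    transpositions acts on every large enough initial segment 0, ..., M.  The
    size of the segment has to be chosen after the word, and to be enlargeable,
    for the induction on the word to go through. *)
Lemma odd_product1 n :
  is_product_of_length (transp 0 1) (1 : S_inf) n -> ~~ odd n.
Proof.
move=> word1; suff : exists N, forall M, (N <= M)%N ->
  exists2 p : 'S_M.+1, (forall x, val (p x) = (1 : S_inf) (val x)) &
    odd_perm p = odd n.
  case=> N /(_ _ (leqnn N)) [p pE <-]; suff -> : p = 1 by rewrite odd_perm1.
  by apply/permP => x; apply: val_inj; rewrite pE S_oneE perm1.
elim: n (1 : S_inf) word1 => [|n IHn] g.
  move=> /product_length0->; exists 0 => M _; exists 1;
    last by rewrite odd_perm1.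
  by move=> x; rewrite perm1 S_oneE.
move=> /product_lengthS[a [b [/sym_class_transp[i [j [/eqP ij ->]]]
  /IHn[N NP] ->]]].
exists (maxn N (maxn i j)) => M; rewrite !geq_max => /and3P[/NP[p pE pn] iM jM].
exists (p * tperm (inord i) (inord j)).
  move=> x; rewrite permM S_mulE -pE transpE; case: tpermP => [->|->|].
  - by rewrite /= !inordK // eqxx.
  - by rewrite /= !inordK // eqxx; case: eqVneq.
  move=> pi pj; rewrite !ifN_eq //; apply/eqP => e.
    by apply: pj; apply: val_inj; rewrite /= inordK.
  by apply: pi; apply: val_inj; rewrite /= inordK.
by rewrite odd_permM odd_tperm pn -(inj_eq val_inj) /= !inordK // ij addbT.
Qed.

Lemma even_perm_length (g : S_inf) n :
  even_perm g -> is_product_of_length (transp 0 1) g n -> ~~ odd n.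
Proof.
move=> /even_permP[m em /product_lengthV gm] gn.
have := product_length_mul gn gm; rewrite mulgV => /odd_product1.
by rewrite oddD (negPf em) addbF.
Qed.

(** * Cycles *)

(** The cycle sending each entry of s to the next one and the last to the first,
    provided that the entries are distinct: products act by their right factor
    first.  Being a word in transpositions, it makes the behaviour under
    conjugation and concatenation a matter of rewriting, for all lists. *)
Fixpoint cyc (s : seq nat) : S_inf :=
  if s is x :: s' then
    if s' is y :: _ then transp x y * cyc s' else 1
  else 1.

Arguments cyc : simpl never.

Lemma cyc0 : cyc [::] = 1. Proof. by []. Qed.

Lemma cyc1 x : cyc [:: x] = 1. Proof. by []. Qed.

Lemma cyc_cons x y s : cyc [:: x, y & s] = transp x y * cyc (y :: s).
Proof. by []. Qed.

Lemma cyc_cat s p t : cyc (s ++ p :: t) = cyc (rcons s p) * cyc (p :: t).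
Proof.
elim: s => [|x [|y s] IHs]; first by rewrite cyc1 mul1g.
  by rewrite /= !cyc_cons cyc1 mulg1.
by rewrite /= !cyc_cons -mulgA -IHs.
Qed.

Lemma cyc_notin s x : x \notin s -> cyc s x = x.
Proof.
elim: s => [|y [|z s] IHs]; rewrite ?cyc0 ?cyc1 ?S_oneE // cyc_cons inE negb_or.
move=> /andP[xy xs]; rewrite S_mulE IHs // transpD //.
by apply: contraNneq xs => ->; rewrite mem_head.
Qed.

Lemma cyc_map (f : S_inf) s : cyc (map f s) = cyc s ^ f^-1.
Proof.
elim: s => [|x [|y s] IHs]; rewrite /= ?cyc0 ?cyc1 ?conj1g // !cyc_cons.
by rewrite conjMg transpJ -IHs.
Qed.

Lemma cyc_rev s : cyc (rev s) = (cyc s)^-1.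
Proof.
elim: s => [|x [|y s] IHs]; rewrite ?cyc0 ?cyc1 ?invg1 //.
rewrite !rev_cons -[rcons (rcons _ _) _]cats1 cat_rcons cyc_cat.
by rewrite -rev_cons IHs !cyc_cons invgM cyc1 mulg1 transpV (transpC x y).
Qed.

Lemma preserve_supp (g : S_inf) (s : seq nat) x :
  (forall x, x \notin s -> g x = x) -> (g x \in s) = (x \in s).
Proof.
move=> gs; case: (boolP (x \in s)) => [|xs]; last by rewrite gs // (negPf xs).
by apply: contraTT => gxs; rewrite -(S_inj (gs _ gxs)).
Qed.

(** A new point u can be inserted into a cycle just after any of its points. *)
Lemma cyc_extend s p u : uniq s -> p \in s -> u \notin s ->
  exists2 s', perm_eq s' (u :: s) & cyc s' = cyc s * transp p u.
Proof.
move=> + ps; case/splitPr: ps => a b us uN.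
exists (a ++ p :: u :: b).
  rewrite -cat_rcons perm_catC /= perm_cons perm_catC cat_rcons //.
rewrite !cyc_cat -mulgA; congr (_ * _).
have {}uN : u \notin b by move: uN; rewrite mem_cat !inE !negb_or => /and3P[].
have {us} pb : p \notin b by move: us; rewrite cat_uniq => /and3P[_ _ /andP[]].
case: b uN pb => [|y b] uN pb; first by rewrite !cyc_cons !cyc1 mul1g mulg1.
rewrite !cyc_cons -mulgA mul_transp !(@cyc_notin (y :: b)) // !mulgA.
congr (_ * _); rewrite (mul_transp (transp p u)) transpR transpD //.
- by move: pb; rewrite inE negb_or eq_sym => /andP[].
- by move: uN; rewrite inE negb_or eq_sym => /andP[].
Qed.

(** * Even permutations as products of two cycles *)

(** Two points u and v are cut out of g, and the factorization g2 = a b obtained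
    on the remaining points is extended.  With p and q the points after which u
    and v were inserted, g = a b (q v)(p u), and this is the product of
    a (b(q) v)(v u) and b (p v)(v u), both of which are cycles a and b extended
    by v and u.  Indeed (b(q) v) and (v u) turn into (q v) and (v u) when moved
    across b, and (v u)(p v)(v u) = (p u).  It is required that v <> p, so that
    p is among the remaining points. *)
Lemma even_two_cycles n (g : S_inf) X : uniq X -> size X = n.*2.+1 ->
    even_perm g -> (forall x, g x != x -> x \in X) ->
  exists s t, [/\ perm_eq s X, perm_eq t X & g = cyc s * cyc t].
Proof.
elim: n g X => [|n IHn] g X uX sX eg gX.
all: have [->|/ex_moved[u gu]] := pselect (g = 1);
  first by exists X, (rev X); rewrite cyc_rev mulgV perm_refl perm_rev.
  have := gX _ gu; have : g u \in X by apply: gX; rewrite (inj_eq (@S_inj g)).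
  case: X sX {uX gX} => [//|x []//] _; rewrite !inE => /eqP gx /eqP ux.
  by rewrite gx ux eqxx in gu.
pose p := g^-1 u; pose g1 := g * transp p u.
have pu : p != u by rewrite inv_fixed.
(* g1 is odd, so it moves some point; as it then moves at least two, one of
   them is not p. *)
have [v g1v vp] : exists2 v, g1 v != v & v != p.
  have /ex_moved[v g1v] : g1 <> 1.
    move=> /mulg1_eq e; have ge : transp p u = g by rewrite -transpV -e invgK.
    have := transp_product_length pu; rewrite ge.
    by move/(even_perm_length eg).
  have [e|] := eqVneq v p; last by exists v.
  rewrite e in g1v; exists (g1 p) => //.
  by rewrite (inj_eq (@S_inj g1)).
pose q := g1^-1 v; pose g2 := g1 * transp q v.
have g1X x : g1 x != x -> x != u /\ g x != x by apply: supp_remove.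
have [vu gv] := g1X _ g1v.
have qv : q != v by rewrite inv_fixed.
have [qu gq] : q != u /\ g q != q by apply: g1X; rewrite S_invKV eq_sym.
have gp : g p != p by rewrite S_invKV eq_sym.
pose Y := rem v (rem u X).
have uXu : uniq (rem u X) by apply: rem_uniq.
have uY : uniq Y by apply: rem_uniq.
have mY x : (x \in Y) = [&& x != v, x != u & x \in X].
  by rewrite mem_rem_uniq // inE mem_rem_uniq // inE.
have XY : perm_eq X [:: u, v & Y].
  apply: (perm_trans (perm_to_rem (gX _ gu))); rewrite perm_cons.
  by apply: perm_to_rem; rewrite mem_rem_uniq // inE vu gX.
have sY : size Y = n.*2.+1 by have := perm_size XY; rewrite sX /= => -[].
have [||s [t [sP tP g2E]]] := IHn g2 Y uY sY.
- have [m em gm] := (even_permP _).1 eg; apply/even_permP.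
  exists (m + 1 + 1)%N; first by rewrite -addnA oddD addbF.
  by do !apply: product_length_mul => //; apply: transp_product_length.
- move=> x /supp_remove[xv /g1X[xu /gX xX]]; rewrite mY; exact/and3P.
have us : uniq s by rewrite (perm_uniq sP).
have ut : uniq t by rewrite (perm_uniq tP).
have vY : v \notin Y by rewrite mY eqxx.
have uY' : u \notin Y by rewrite mY eqxx andbF.
have pY : p \in Y by rewrite mY eq_sym vp pu gX.
have qY : q \in Y by rewrite mY qv qu gX.
have ext w r : uniq r -> w \in Y -> perm_eq r Y ->
    exists2 r', perm_eq r' X & cyc r' = cyc r * transp w v * transp v u.
  move=> ur wY rY; have [||r1 r1P r1E] := @cyc_extend r w v ur.
  - by rewrite (perm_mem rY).
  - by rewrite (perm_mem rY).
  have [|||r2 r2P r2E] := @cyc_extend r1 v u.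
  - by rewrite (perm_uniq r1P) /= (perm_mem rY) vY.
  - by rewrite (perm_mem r1P) mem_head.
  - by rewrite (perm_mem r1P) inE (perm_mem rY) negb_or eq_sym vu.
  exists r2; last by rewrite r2E r1E.
  rewrite (perm_trans r2P) // perm_sym (perm_trans XY) // perm_cons.
  by rewrite perm_sym (perm_trans r1P) // perm_cons.
have tY x : x \notin Y -> cyc t x = x.
  by move=> xY; rewrite cyc_notin // (perm_mem tP).
have tqY : cyc t q \in Y by rewrite preserve_supp.
have [s' s'P s'E] := ext (cyc t q) s us tqY sP.
have [t' t'P t'E] := ext p t ut pY tP.
exists s', t'; split=> //; rewrite s'E t'E.
have -> : g = g2 * transp q v * transp p u by rewrite !transpMK.
rewrite g2E.
have cv : cyc t * transp v u = transp v u * cyc t by rewrite mul_transp !tY.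
have -> : cyc s * transp (cyc t q) v * transp v u *
    (cyc t * transp p v * transp v u) =
    cyc s * cyc t * transp q v * (transp v u * transp p v * transp v u).
  rewrite -(mulgA (cyc s) (cyc t)) (mul_transp (cyc t) q) (tY v vY) !mulgA.
  by rewrite -(mulgA _ (transp v u) (cyc t)) -cv mulgA.
congr (_ * _); rewrite (mul_transp (transp v u) p) transpL transpD ?transpMK //.
by rewrite eq_sym.
Qed.

(** * Joining a permutation with a conjugate *)

(** Insert u after p in h.  A conjugate k of h with h k = cyc s is given by
    induction, p being an entry of s.  If f1 conjugates h to k, sends p to q and
    is corrected to send u to w, it conjugates h (p u) to k (q w), and the new
    product h (p u) k (q w) is h k (k^-1(p) u)(q w): the cycle s with u inserted
    and then w.  This needs u to be outside s, and q but not w to be in s or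
    equal to u.

    The induction hypothesis provides this as follows.  The point p0 is there to
    be taken as p, which h may well fix; the conjugate then has to be allowed to
    run through one point fixed by h, and this is how a new cycle of h gets
    attached to the old ones.  The list F is there to contain u: it is a list of
    points that s avoids, except for those moved by h and for p0. *)
Lemma join_conjugate (h : S_inf) (p0 : nat) (F : seq nat) :
  exists n (f : S_inf) s,
    [/\ is_product_of_length (transp 0 1) h n, uniq s, size s = n.*2.+1 &
        h * h ^ f^-1 = cyc s] /\
    [/\ p0 \in s, forall x, x \notin s -> (h ^ f^-1) x = x &
        forall x, x \in s -> x \in F -> h x != x \/ x = p0].
Proof.
elim/S_inf_ind: h p0 F => [|h p u pu hu IHh] p0 F.
  exists 0%N, 1, [:: p0]; do !split=> //.
  - exact/product_length0.
  - by rewrite conj1g mulg1.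
  - exact: mem_head.
  - by move=> x _; rewrite conj1g S_oneE.
  - by move=> x; rewrite inE => /eqP ->; right.
set h' := h * transp p u.
have h'u : h' u != u.
  by rewrite S_mulE transpR; apply: contra_neq pu => e; apply: (@S_inj h);
    rewrite hu.
have h'p : h' p != p by rewrite S_mulE transpL hu eq_sym.
have h'h x : h x != x -> h' x != x.
  move=> hx; have [->//|xp] := eqVneq x p; rewrite S_mulE transpD //.
  by apply: contraNneq hx => ->; rewrite hu.
have [n [f [s [[hn us sn cE] [ps ks sF]]]]] := IHh p (u :: F).
have uN : u \notin s.
  apply/negP => /sF/(_ (mem_head _ _))[|/eqP]; first by rewrite hu eqxx.
  by rewrite eq_sym (negPf pu).
(* w also has to take care of p0, unless p0 is already on the cycle. *)
have [w [wN p0w wF]] : exists w, [/\ w \notin u :: s, p0 \in [:: w, u & s] &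
    w \in F -> w = p0].
  have [p0s|p0N] := boolP (p0 \in u :: s); last first.
    by exists p0; rewrite mem_head.
  have [w] := exists_notin ((u :: s) ++ F);
    rewrite mem_cat negb_or => /andP[wN wF].
  by exists w; rewrite wN (negPf wF) inE p0s orbT.
have [k kE] : exists k, h ^ f^-1 = k by exists (h ^ f^-1).
rewrite kE in cE ks.
(* When f p is off the cycle k fixes it, so that it can be traded for u. *)
have [f1 f1k qs] : exists2 f1 : S_inf, h ^ f1^-1 = k & f1 p \in u :: s.
  have [fps|fpN] := boolP (f p \in s); first by exists f;
    rewrite ?inE ?fps ?orbT.
  exists (transp (f p) u * f); last by rewrite S_mulE transpL mem_head.
  by rewrite invgM transpV conjgM kE conj_transp_fix ?ks.
have kw : k w = w by apply: ks; apply: contraNN wN; rewrite inE orbC => ->.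
have kf1u : k (f1 u) = f1 u by rewrite -f1k conjgE invgK !S_mulE S_invK hu.
pose f2 := transp (f1 u) w * f1.
have f2k : h ^ f2^-1 = k by rewrite invgM transpV conjgM f1k conj_transp_fix.
have f2u : f2 u = w by rewrite S_mulE transpL.
have f2p : f2 p = f1 p.
  rewrite S_mulE transpD ?(inj_eq (@S_inj f1)) //.
  by apply: contraNneq wN => <-.
have k'E : h' ^ f2^-1 = k * transp (f1 p) w by rewrite conjMg f2k transpJ f2p
  f2u.
have kVps : k^-1 p \in s by rewrite -(preserve_supp _ ks) S_invKV.
have [s1 s1P s1E] := cyc_extend us kVps uN.
have us1 : uniq s1 by rewrite (perm_uniq s1P) /= uN.
have [||s2 s2P s2E] := @cyc_extend s1 (f1 p) w us1; rewrite ?(perm_mem s1P) //.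
have ms2 : s2 =i [:: w, u & s].
  by move=> x; rewrite (perm_mem s2P) [LHS]inE [RHS]inE (perm_mem s1P).
exists n.+1, f2, s2; split; split.
- by rewrite -[n.+1]addn1; apply: product_length_mul => //;
    apply: transp_product_length.
- by rewrite (perm_uniq s2P) /= us1 (perm_mem s1P) wN.
- by rewrite (perm_size s2P) /= (perm_size s1P) /= sn.
- rewrite k'E s2E s1E -cE /h' -!mulgA; congr (_ * _); rewrite !mulgA.
  by rewrite (mul_transp k) S_invKV ks.
- by rewrite ms2.
- move=> x; rewrite ms2 inE negb_or => /andP[xw xN];
    rewrite k'E S_mulE transpD //.
    by apply: ks; apply: contraNN xN; rewrite inE orbC => ->.
  by apply: contraNneq xN => ->.
- move=> x; rewrite ms2 !inE => /or3P[/eqP->/wF|/eqP->|xs xF]; first by right.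
    by left.
  by have [/h'h|->] := sF x xs (mem_behead (s := u :: F) xF); left.
Qed.

(** * Four conjugates *)

Lemma product_support (g : S_inf) n : is_product_of_length (transp 0 1) g n ->
  exists2 l : seq nat, size l = n.*2 & forall x, g x != x -> x \in l.
Proof.
elim: n g => [|n IHn] g.
  by move=> /product_length0->; exists [::] => // x; rewrite S_oneE eqxx.
move=> /product_lengthS[a [b [/sym_class_transp[i [j [_ ->]]] /IHn[l lE lP]
  ->]]].
exists [:: i, j & l] => [|x]; first by rewrite /= lE.
rewrite S_mulE !inE; have [->|/lP->] := eqVneq (b x) x; last by rewrite !orbT.
by case: (eqVneq x i) => //= xi; case: (eqVneq x j) => //= xj;
  rewrite transpD ?eqxx.
Qed.

Lemma enlarge_uniq (l : seq nat) n : (size l <= n)%N ->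
  exists X : seq nat, [/\ uniq X, size X = n & {subset l <= X}].
Proof.
elim: n l => [|n IHn] [|x l] //= ln; first by exists [::].
  have [X [uX sX _]] := IHn [::] isT; have [y yX] := exists_notin X.
  by exists (y :: X); rewrite /= yX sX.
have [X [uX sX lX]] := IHn l ln; have [xX|xX] := boolP (x \in X).
  have [y yX] := exists_notin X; exists (y :: X); split; rewrite /= ?yX ?sX //.
  by move=> z; rewrite !inE => /predU1P[->|/lX->]; rewrite ?xX orbT.
exists (x :: X); split; rewrite /= ?xX ?sX //.
by move=> z; rewrite !inE => /predU1P[->|/lX->]; rewrite ?eqxx ?orbT.
Qed.

(** The bound m <= l enters by 2m <= 2l < 2n + 1, where 2n + 1 is the length of
    the cycle formed by h and a conjugate of it. *)
Lemma four_conjugates (h g : S_inf) l m :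
    (forall k, is_product_of_length (transp 0 1) h k -> (l <= k)%N) ->
    is_product_of_length (transp 0 1) g m -> ~~ odd m -> (m <= l)%N ->
  is_product_of_length h g 4.
Proof.
move=> min_l gm em ml.
have [n [f [s [[/min_l ln us sn cE] _]]]] := join_conjugate h 0 [::].
have cyc2 t : uniq t -> size t = n.*2.+1 -> is_product_of_length h (cyc t) 2.
  move=> ut st; have [|||e <-] := @extend_injection s t; rewrite ?sn ?st //.
  rewrite cyc_map -cE; apply: product_lengthJ;
    apply: (@product_length_mul _ _ _ _ 1 1).
    exact/product_length1/sym_class_refl.
  exact/product_length1/sym_classJ/sym_class_refl.
have [L sL gL] := product_support gm.
have [|X [uX sX LX]] := @enlarge_uniq L n.*2.+1.
  by rewrite sL leqW // leq_double (leq_trans ml).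
have [|x /gL/LX //|t1 [t2 [t1P t2P ->]]] := even_two_cycles uX sX (g := g).
  by apply/even_permP; exists m.
apply: (@product_length_mul _ _ _ _ 2 2); apply: cyc2.
- by rewrite (perm_uniq t1P).
- by rewrite (perm_size t1P).
- by rewrite (perm_uniq t2P).
- by rewrite (perm_size t2P).
Qed.

(** The word is cut into pieces of l transpositions; l has to be even for the
    pieces to be even permutations. *)
Lemma chunks_of_conjugates (h g : S_inf) l k m :
    (forall k, is_product_of_length (transp 0 1) h k -> (l <= k)%N) ->
    ~~ odd l ->
    is_product_of_length (transp 0 1) g m -> ~~ odd m -> (m <= k * l)%N ->
  is_product_of_length h g (k * 4).
Proof.
move=> min_l el; elim: k m g => [|k IHk] m g gm em ml.
  move: gm; have -> : m = 0%N by apply/eqP; rewrite -leqn0.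
  by move=> /product_length0->; apply/product_length0.
have mE : (minn m l + (m - l) = m)%N by rewrite minnE subnK // leq_subr.
have eml : ~~ odd (minn m l) by rewrite /minn; case: ifP.
move: gm; rewrite -mE => /product_length_split[a [b [am bm ->]]].
rewrite mulSn; apply: product_length_mul.
  by apply: (four_conjugates min_l am); rewrite // geq_minr.
apply: (IHk _ _ bm); last by rewrite leq_subLR.
by have := congr1 odd mE; rewrite oddD (negPf eml) (negPf em) => /= ->.
Qed.

(** * Passing to the alternating group *)

(** An odd conjugator can be made even without changing the conjugate, by
    multiplying it by a transposition of two points fixed by h. *)
Lemma sym_class_A_inf (h : A_inf) (a : S_inf) : sym_class (val h) a ->
  exists2 a' : A_inf, sym_class h a' & val a' = a.
Proof.
have conj_alt (k : A_inf) (x : S_inf) :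
    exists y : A_inf, val k ^ val y = val k ^ x.
  have [n xn] := exists_transp_product x.
  have [on|en] := boolP (odd n); last first.
    have ex : even_perm x by apply/even_permP; exists n.
    by exists (AInf ex).
  have [l kl] := S_inf_support (val k).
  have [i il] := exists_notin l; have [j] := exists_notin (i :: l).
  rewrite inE negb_or eq_sym => /andP[ij jl].
  have ex : even_perm (transp i j * x).
    apply/even_permP; exists (1 + n)%N; first by rewrite /= on.
    by apply: product_length_mul => //; apply: transp_product_length.
  exists (AInf ex); rewrite /= conjgM conj_transp_fix //; apply/eqP.
    by apply: contraNT il => /kl.
  by apply: contraNT jl => /kl.
case=> -[x _ <-].
  by have [y <-] := conj_alt h x; exists (h ^ y); [left;
    exists y | rewrite gmulfJ].
have [y] := conj_alt h^-1 x; rewrite gmulfV => <-.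
by exists (h^-1 ^ y); [right; exists y | rewrite gmulfJ gmulfV].
Qed.

Lemma product_length_A_inf (h g : A_inf) n :
  is_product_of_length (val h) (val g) n -> is_product_of_length h g n.
Proof.
elim: n g => [|n IHn] g.
  by move=> /product_length0 g1; apply/product_length0/val_inj;
    rewrite g1 gmulf1.
move=> /product_lengthS[a [b [/sym_class_A_inf[a' a'P <-] bP gE]]].
apply/product_lengthS; exists a', (a'^-1 * g); rewrite mulVKg; split=> //.
by apply: IHn; rewrite gmulfM gmulfV /= gE mulKg.
Qed.

Lemma product_length_val (h g : A_inf) n :
  is_product_of_length h g n -> is_product_of_length (val h) (val g) n.
Proof.
case=> s sP ->; exists (fun i => val (s i)); last by rewrite gmulf_prod.
by move=> i; case: (sP i) => -[x _ <-]; rewrite gmulfJ ?gmulfV; [left|right];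
  exists (val x).
Qed.

(** * The bounds *)

Import GRing.Theory Num.Theory Order.TTheory.

Theorem proposition4 (g h : A_inf) (g_neq1 : g <> 1%g) (h_neq1 : h <> 1%g) :
  (transp_length g / transp_length h <= word_length h g)%E /\
  (word_length h g <= 4%:E * (transp_length g / transp_length h) + 4%:E)%E.
Proof.
have [? /word_lengthP[L [gE gL minL]]] := exists_transp_product g.
have [? /word_lengthP[l [hE hl minl]]] := exists_transp_product h.
have eL : ~~ odd L by apply: even_perm_length gL; apply: valP.
have el : ~~ odd l by apply: even_perm_length hl; apply: valP.
have l_gt0 : (0 < l)%N.
  rewrite lt0n; apply/eqP => l0; apply: h_neq1; apply: val_inj.
  by move: hl; rewrite l0 gmulf1 => /product_length0.
have upper : is_product_of_length h g ((L %/ l).+1 * 4).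
  apply: product_length_A_inf; apply: (chunks_of_conjugates minl el gL eL).
  exact/ltnW/ltn_ceil.
have [n [-> gn minn]] := word_lengthP upper.
have {minn} nle := minn _ upper.
have Lle : (L <= n * l)%N.
  by apply: minL; apply: product_length_trans hl _; apply: product_length_val.
rewrite /transp_length gE hE.
have l0 : (0 < l%:R :> rat)%R by rewrite ltr0n.
rewrite inver gt_eqF // -EFinM -EFinM -EFinD !lee_fin.
split; first by rewrite ler_pdivrMr // -natrM ler_nat.
apply: (@le_trans _ _ (((L %/ l).+1 * 4)%N%:R)%R); first by rewrite ler_nat.
rewrite natrM -natr1 mulrC mulrDr mulr1 lerD2r ler_pM2l //.
by rewrite ler_pdivlMr // -natrM ler_nat leq_divM.
Qed.
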